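(* For every integer $n\ge 3$, $$ t_n>\log_n E(\{0,1,\dots,n-1\})=\log_n\frac{2n^3+n}{3}. $$
   Context: For a finite subset $A$ of an abelian group, its additive energy is $E(A)=\#\{(a_1,a_2,a_3,a_4)\in A^4: a_1+a_2=a_3+a_4\}$. For an integer $n\ge2$, $t_n$ denotes the smallest real number such that $E(A)\le |A|^{t_n}$ for every positive integer $d$ and every subset $A\subset\{0,1,\dots,n-1\}^d$ (viewed in $\mathbb{Z}^d$). *)

(* Defs.v *)
From mathcomp Require Import all_boot all_order all_algebra finmap.
From mathcomp Require Import all_classical all_reals all_analysis.

Set Implicit Arguments.
Unset Strict Implicit.
Unset Printing Implicit Defensive.

Import Order.TTheory GRing.Theory Num.Theory.

Local Open Scope classical_set_scope.
Local Open Scope ring_scope.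

Definition additive_energy (G : zmodType) (A : {fset G}) : nat :=
  #|` [fset q in (A `*` A) `*` (A `*` A) |
        (q.1.1 + q.1.2 == q.2.1 + q.2.2)%R]%fset|.

Definition int_segment (n : nat) : {fset int} :=
  [fset k%:Z | k in iota 0 n]%fset.

Definition in_box (n d : nat) (A : {fset 'rV[int]_d}) : Prop :=
  forall a, a \in A -> forall i, a ord0 i \in int_segment n.

Definition energy_exponents (R : realType) (n : nat) : set R :=
  [set t | forall d (A : {fset 'rV[int]_d}), (0 < d)%N -> in_box n A ->
    (additive_energy A)%:R <= #|` A|%:R `^ t].

Arguments energy_exponents : clear implicits.

(* For n >= 2 the infimum is a minimum: see energy_exponent_min below. *)
Definition energy_exponent (R : realType) (n : nat) : R :=
  inf (energy_exponents R n).

Definition logb (R : realType) (b x : R) : R := ln x / ln b.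

Lemma additive_energy_le3 (G : zmodType) (A : {fset G}) :
  (additive_energy A <= #|` A| ^ 3)%N.
Proof.
rewrite /additive_energy; set Q := [fset q in _ | _]%fset.
have inj : {in Q &, injective (fun q : (G * G) * (G * G) => (q.1, q.2.1))}.
  move=> [[a b] [c d]] [[a' b'] [c' d']]; rewrite !inE /=.
  move=> /andP[_ /eqP e] /andP[_ /eqP e'] [aa bb cc].
  have : c + d = c' + d' by rewrite -e -e' aa bb.
  by rewrite aa bb cc => /addrI ->.
rewrite -(size_map (fun q : (G * G) * (G * G) => (q.1, q.2.1)) Q).
have -> : (#|` A| ^ 3)%N =
    size [seq (p, c) | p <- [seq (a, b) | a <- A, b <- A], c <- A].
  by rewrite !size_allpairs !expnS expn0 muln1 mulnA.
apply: uniq_leq_size; first by rewrite map_inj_in_uniq ?fset_uniq.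
move=> x /mapP[[[a b] [c d]]]; rewrite !inE /=.
move=> /andP[/andP[/andP[aA bA] /andP[cA _]] _] ->.
by apply: allpairs_f => //; apply: allpairs_f.
Qed.

Lemma additive_energy_gt0 (G : zmodType) (A : {fset G}) :
  A != fset0 -> (0 < additive_energy A)%N.
Proof.
move=> /fset0Pn[a aA]; rewrite /additive_energy cardfs_gt0; apply/fset0Pn.
by exists ((a, a), (a, a)); rewrite !inE /= aA /= eqxx.
Qed.

Lemma energy_exponent_min (R : realType) (n : nat) : (2 <= n)%N ->
  energy_exponents R n (energy_exponent R n) /\
  lbound (energy_exponents R n) (energy_exponent R n).
Proof.
move=> n2.
have ne : energy_exponents R n !=set0.
  exists 3%:R => d A _ _; rewrite powR_mulrn// -natrX ler_nat.
  exact: additive_energy_le3.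
have lb : has_lbound (energy_exponents R n).
  exists 0 => t /(_ 1%N [fset const_mx 0; const_mx 1]%fset isT) h.
  have cA : #|` [fset const_mx 0; const_mx 1 : 'rV[int]_1]%fset| = 2%N.
    rewrite cardfs2; case: eqP => // /matrixP/(_ ord0 ord0).
    by rewrite !mxE.
  have /h : in_box n [fset const_mx 0; const_mx 1 : 'rV[int]_1]%fset.
    move=> a; rewrite !inE => /orP[]/eqP-> i; rewrite mxE; apply/imfsetP.
      by exists 0%N => //=; rewrite mem_iota (leq_trans _ n2).
    by exists 1%N => //=; rewrite mem_iota (leq_trans _ n2).
  rewrite cA; set E := additive_energy _ => hE.
  have E0 : (0 < E)%N.
    by apply: additive_energy_gt0; rewrite -cardfs_gt0 cA.
  rewrite leNgt; apply/negP => t0.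
  have : 2%:R `^ t < 1 :> R.
    rewrite -(ltr_ln (R := R)) ?posrE ?powR_gt0// ln1 ln_powR.
    by rewrite nmulr_rlt0// ln_gt0// ltr1n.
  by rewrite ltNge (le_trans _ hE)// ler1n.
split; last exact: ge_inf.
move=> d A d0 AB; have [A1|A1] := leqP #|` A| 1.
  have [t /(_ d A d0 AB)] := ne.
  case: (posnP #|` A|) => [/cardfs0_eq ->|A0].
    move=> _; suff -> : additive_energy (fset0 : {fset 'rV[int]_d}) = 0%N.
      exact: powR_ge0.
    by apply/eqP; rewrite -leqn0 (leq_trans (additive_energy_le3 _))// cardfs0.
  have -> : #|` A| = 1%N by apply/eqP; rewrite eqn_leq A1.
  by rewrite !powR1.
have E0 : (0 < additive_energy A)%N.
  by apply: additive_energy_gt0; rewrite -cardfs_gt0 (ltn_trans _ A1).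
have lA : 0 < ln (#|` A|%:R : R) by rewrite ln_gt0// ltr1n.
have A0 : 0 < #|` A|%:R :> R by rewrite ltr0n (ltn_trans _ A1).
have key t : ((additive_energy A)%:R <= #|` A|%:R `^ t) =
    (ln (additive_energy A)%:R / ln (#|` A|%:R : R) <= t).
  by rewrite ler_pdivrMr// -ln_powR ler_ln// posrE ?powR_gt0// ltr0n.
rewrite key; apply: lb_le_inf => // t /(_ d A d0 AB); by rewrite key.
Qed.

(* Main.v *)
(* The uniform distribution on the solutions of
   a1 + a2 = a3 + a4 in {0, ..., n-1} has a non-uniform marginal, since it gives
   0 a probability p < 1/n as soon as n >= 3. Fix p < theta < 1/n and let A be
   the set of words of length d over {0, ..., n-1} with at most theta * d zeros.
   By Chernoff's bound, A misses only an exponentially small proportion of the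
   E^d additive quadruples of {0, ..., n-1}^d, where E = E({0, ..., n-1}), while
   |A| is exponentially smaller than n^d; hence E(A) > |A|^(log_n E) for d
   large. *)

Require Import Defs.
From mathcomp Require Import all_boot all_order all_algebra finmap.
From mathcomp Require Import all_classical all_reals all_analysis.
From mathcomp Require Import ring lra zify.

Set Implicit Arguments.
Unset Strict Implicit.
Unset Printing Implicit Defensive.

Import Order.TTheory GRing.Theory Num.Theory.
Import numFieldNormedType.Exports.

Local Open Scope ring_scope.

(** * Chernoff bounds for letter counts in words *)

(** The exponent is minus the Poisson relative entropy [theta * ln (theta / p) - theta + p]. *)
Definition chernoff_rate (R : realType) (p theta : R) : R :=
  expR (theta - p - theta * ln (theta / p)).

(** With [u = ln (p / theta)], negativity of the exponent reads
    [theta * (1 + u) < p = theta * expR u], which is the strict inequality [1 + u < expR u] for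
    [u != 0]. *)
Lemma chernoff_rate_lt1 (R : realType) (p theta : R) :
  0 < p -> 0 < theta -> theta != p -> chernoff_rate p theta < 1.
Proof.
move=> p0 t0 tp; rewrite /chernoff_rate expR_lt1.
have -> : ln (theta / p) = - ln (p / theta).
  by rewrite -lnV ?posrE ?divr_gt0// invf_div.
set u := ln (p / theta).
have hu : expR u = p / theta by rewrite lnK// posrE divr_gt0.
have u0 : u != 0.
  apply/negP => /eqP u0; move: hu; rewrite u0 expR0 => /esym/divr1_eq pt.
  by rewrite pt eqxx in tp.
have := expR_gt1Dx u0; rewrite hu ltr_pdivlMr//; lra.
Qed.

Definition occurrences (d : nat) (T : finType) (B : {set T})
  (w : {ffun 'I_d -> T}) : nat := #|[set i | w i \in B]|.

(* The exponential moment is taken at the optimal tilt theta / p, so that one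
   statement covers the upper tail (theta > p) and the lower tail (theta < p). *)
Lemma chernoff_bound (R : realType) (T : finType) (D B : {set T}) (d : nat)
    (p theta : R) (S : {set {ffun 'I_d -> T}}) :
  0 < p -> 0 < theta -> #|D :&: B|%:R = p * #|D|%:R ->
  {in S, forall w, w \in ffun_on D /\
     (theta / p) `^ (theta * d%:R) <= (theta / p) ^+ occurrences B w} ->
  #|S|%:R <= (#|D|%:R * chernoff_rate p theta) ^+ d.
Proof.
move=> p0 t0 hp hS; set y := theta / p.
have y0 : 0 < y by rewrite divr_gt0.
pose F t : R := if t \in B then y else 1.
have sumF : \sum_(t in D) F t = #|D|%:R * (1 + (theta - p)).
  rewrite (big_setID B) /= /F.
  under eq_bigr => t /setIP[_ ->] do over.
  under [X in _ + X]eq_bigr => t /setDP[_ /negbTE ->] do over.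
  rewrite !sumr_const -[#|D :\: B|](addKn #|D :&: B|) cardsID.
  rewrite natrB ?subset_leq_card ?subsetIl// -[X in X + _]mulr_natr hp /y.
  by field; rewrite gt_eqF.
have F0 t : 0 <= F t by rewrite /F; case: ifP => // _; exact: ltW.
(* The weight [y ^+ occurrences B w] is a product of [F] over the letters of [w], so the sum over
   words factors. *)
have moment : \sum_(w : {ffun 'I_d -> T} | w \in ffun_on D) y ^+ occurrences B w =
    (\sum_(t in D) F t) ^+ d.
  transitivity (\prod_(i < d) \sum_(t in D) F t).
    rewrite bigA_distr_big; apply: eq_bigr => w _.
    by rewrite -big_mkcond prodr_const /occurrences cardsE.
  by rewrite prodr_const card_ord.
have pw : y `^ (theta * d%:R) = expR (theta * ln y) ^+ d.
  by rewrite /powR gt_eqF// -expRM_natl; congr expR; ring.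
(* Markov's inequality, followed by [1 + x <= expR x] at [x = theta - p]. *)
have : #|S|%:R * expR (theta * ln y) ^+ d <=
    (#|D|%:R * expR (theta - p)) ^+ d.
  rewrite mulr_natl -sumr_const.
  apply: (@le_trans _ _ (\sum_(w in S) y ^+ occurrences B w)).
    by apply: ler_sum => w /hS[_]; rewrite -/y pw.
  apply: (@le_trans _ _ (\sum_(w : {ffun 'I_d -> T} | w \in ffun_on D)
    y ^+ occurrences B w)).
    rewrite [leRHS](bigID (mem S)) /=.
    rewrite [X in _ <= X + _](_ : _ = \sum_(w in S) y ^+ occurrences B w).
      by rewrite lerDl sumr_ge0// => w _; rewrite exprn_ge0// ltW.
    apply: eq_bigl => w; case: (boolP (w \in S)) => [/hS[-> _]//|].
    by rewrite andbF.
  rewrite moment lerXn2r ?nnegrE ?mulr_ge0 ?expR_ge0 ?sumr_ge0//.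
  by rewrite sumF ler_wpM2l ?expR_ge1Dx.
rewrite -ler_pdivlMr ?exprn_gt0 ?expR_gt0// => hle; apply: (le_trans hle).
by rewrite -expr_div_n /chernoff_rate [X in _ <= (_ * X) ^+ _]expRB mulrA.
Qed.

(** * Counting additive quadruples in a segment *)

Lemma additive_energy_imfset (G : zmodType) (T : finType) (e : T -> G)
    (F : {set T}) : injective e ->
  additive_energy [fset e x | x in F]%fset =
  #|[set q : (T * T) * (T * T) |
      [&& q.1.1 \in F, q.1.2 \in F, q.2.1 \in F, q.2.2 \in F &
          e q.1.1 + e q.1.2 == e q.2.1 + e q.2.2]]|.
Proof.
move=> inj; rewrite /additive_energy; set Q := [set q | _].
pose h (q : (T * T) * (T * T)) := ((e q.1.1, e q.1.2), (e q.2.1, e q.2.2)).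
have h_inj : injective h.
  by move=> [[a b] [c d]] [[a' b'] [c' d']] [/inj-> /inj-> /inj-> /inj->].
rewrite cardE -(size_map h) cardfE cardE -(size_map val).
apply/perm_size/uniq_perm.
- by rewrite map_inj_uniq ?enum_uniq//; exact: val_inj.
- by rewrite map_inj_uniq// enum_uniq.
move=> x; rewrite -(enum_fsetE); apply/idP/mapP.
  case: x => [[a b] [c d]]; rewrite !inE /= => /andP[/andP[/andP[]]].
  move=> /imfsetP[a' /= aF ->] /imfsetP[b' /= bF ->].
  move=> /andP[/imfsetP[c' /= cF ->] /imfsetP[d' /= dF ->]] E.
  exists ((a', b'), (c', d')) => //.
  by rewrite mem_enum inE /= aF bF cF dF.
move=> [[[a b] [c d]]]; rewrite mem_enum inE /= => /and5P[aF bF cF dF E] ->.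
by rewrite !inE /= E !in_imfset.
Qed.

(** This set also serves as an alphabet: addition being coordinatewise, its words of length [d]
    encode the additive quadruples of the whole box. *)
Definition quads (n : nat) : {set ('I_n * 'I_n) * ('I_n * 'I_n)} :=
  [set q | (val q.1.1 + val q.1.2 == val q.2.1 + val q.2.2)%N].

Lemma additive_energy_int_segment (n : nat) :
  additive_energy (int_segment n) = #|quads n|.
Proof.
pose e (i : 'I_n) : int := (i : nat)%:Z.
have -> : int_segment n = [fset e x | x in [set: 'I_n]%SET]%fset.
  apply/fsetP => z; apply/imfsetP/imfsetP => /= -[k].
    by rewrite mem_iota /= add0n => kn ->; exists (Ordinal kn); rewrite ?inE.
  by move=> _ ->; exists (val k) => //; rewrite mem_iota /= add0n.
rewrite additive_energy_imfset; last by move=> i j [/val_inj].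
by apply: eq_card => q; rewrite !inE.
Qed.

(** The entry [b] forces [d = a + b - c], so the count is that of the [b] for which this lies in the
    range. With truncated subtraction, [(a - c) + (c - a)] is the distance from [a] to [c]. *)
Lemma card_ord_shift (n a c : nat) : (a < n)%N -> (c < n)%N ->
  (\sum_(b < n) \sum_(d < n) (a + b == c + d) = n - ((a - c) + (c - a)))%N.
Proof.
move=> an cn.
have inner (b : 'I_n) :
    (\sum_(d < n) (a + b == c + d) = (c <= a + b < c + n))%N.
  case: (boolP (c <= a + b < c + n)%N) => h.
    have hd : (a + b - c < n)%N by lia.
    rewrite (bigD1 (Ordinal hd)) //= big1 => [|d /eqP dh]; first by lia.
    apply/eqP; rewrite eqb0; apply/eqP => e; apply: dh; apply/val_inj => /=; lia.
  rewrite big1 // => d _; apply/eqP; rewrite eqb0; apply/eqP => e.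
  have := ltn_ord d; lia.
rewrite (eq_bigr _ (fun b _ => inner b)).
rewrite -(big_mkord xpredT (fun b => nat_of_bool (c <= a + b < c + n)%N)).
have [ac|/ltnW ca] := leqP a c.
  rewrite (@big_cat_nat _ _ _ (c - a)) /=; [|lia|lia].
  rewrite big_nat_cond big1 ?add0n; last by move=> i; lia.
  rewrite big_nat_cond (eq_bigr (fun=> 1%N)); last by move=> i; lia.
  rewrite -big_nat_cond sum_nat_const_nat; lia.
rewrite (@big_cat_nat _ _ _ (n - (a - c))) /=; [|lia|lia].
rewrite [X in (_ + X)%N]big_nat_cond [X in (_ + X)%N]big1 ?addn0;
  last by move=> i; lia.
rewrite big_nat_cond (eq_bigr (fun=> 1%N)); last by move=> i; lia.
rewrite -big_nat_cond sum_nat_const_nat; lia.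
Qed.

(** The predicate allows one computation to serve both the total energy and the marginal at zero. *)
Lemma card_quads_cond (n : nat) (P : pred 'I_n) :
  #|[set q in quads n | P q.1.1]| =
  (\sum_(a < n | P a) \sum_(c < n) (n - ((a - c) + (c - a))))%N.
Proof.
rewrite -sum1_card big_mkcond /=.
under eq_bigr => q _ do rewrite !inE /=.
rewrite -(pair_bigA _ (fun x y =>
  if (val x.1 + val x.2 == val y.1 + val y.2)%N && P x.1
  then 1%N else 0%N)) /=.
under eq_bigr => x _ do rewrite -(pair_bigA _ (fun c d =>
  if (val x.1 + val x.2 == val c + val d)%N && P x.1 then 1%N else 0%N)) /=.
rewrite -(pair_bigA _ (fun a b => \sum_(c < n) \sum_(d < n)
  if (val a + val b == val c + val d)%N && P a then 1%N else 0%N)%N) /=.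
rewrite [RHS]big_mkcond; apply: eq_bigr => a _; case: (P a); last first.
  rewrite big1 // => b _; rewrite big1 // => c _; rewrite big1 // => d _.
  by rewrite andbF.
rewrite exchange_big; apply: eq_bigr => c _.
rewrite -card_ord_shift //; apply: eq_bigr => b _; apply: eq_bigr => d _.
by rewrite andbT; case: eqP.
Qed.

(** Separating [k] from [n] lets the induction run with [n] fixed; at [k = n] the sum is
    n(n+1)/2. *)
Lemma sum_ord_down (n k : nat) : (k <= n)%N ->
  (2 * \sum_(c < k) (n - c) + k * k = k * (2 * n).+1)%N.
Proof.
elim: k => [|k IH] kn; first by rewrite big_ord0.
rewrite big_ord_recr /=; have := IH (ltnW kn).
by set X := bigop _ _ _; nia.
Qed.

Lemma card_quads (n : nat) : (3 * #|quads n| = 2 * n ^ 3 + n)%N.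
Proof.
have -> : #|quads n| = #|[set q in quads n | predT q.1.1]|.
  by apply: eq_card => q; rewrite !inE andbT.
rewrite card_quads_cond.
(* Passing to complements, it suffices that the distances sum to (n^3 - n)/3; induction on [n] peels
   off the last row and column. *)
suff: (3 * \sum_(a < n) \sum_(c < n) ((a - c) + (c - a)) + n = n ^ 3)%N.
  have : (\sum_(a < n) \sum_(c < n) (n - (a - c + (c - a))) +
     \sum_(a < n) \sum_(c < n) (a - c + (c - a)) = n ^ 3)%N.
    rewrite -big_split /=.
    under eq_bigr => a _.
      rewrite -big_split /=.
      under eq_bigr => c _.
        rewrite subnK; last by have := ltn_ord a; have := ltn_ord c; lia.
        over.
      rewrite sum_nat_const card_ord; over.
    by rewrite sum_nat_const card_ord.
  by set X := bigop _ _ _; set Y := bigop _ _ _; lia.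
elim: n => [|n IH]; first by rewrite big_ord0.
rewrite big_ord_recr /=.
under eq_bigr => a _ do rewrite big_ord_recr /=.
rewrite big_split /= big_ord_recr /=.
have e1 : (\sum_(i < n) (i - n + (n - i)) = \sum_(c < n) (n - c))%N.
  by apply: eq_bigr => i _; have := ltn_ord i; lia.
have e2 : (\sum_(i < n) (n - i + (i - n)) = \sum_(c < n) (n - c))%N.
  by apply: eq_bigr => i _; have := ltn_ord i; lia.
rewrite e1 e2; have := sum_ord_down (leqnn n); move: IH.
by set X := bigop _ _ _; set Y := bigop _ _ _; rewrite !expnS !expn0; nia.
Qed.

Lemma card_quads0 (n : nat) (z : 'I_n) : val z = 0%N ->
  (2 * #|[set q in quads n | q.1.1 == z]| = n * n.+1)%N.
Proof.
move=> z0; rewrite (card_quads_cond (pred1 z)) big_pred1_eq z0.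
under eq_bigr => c _ do rewrite sub0n add0n subn0.
by have := sum_ord_down (leqnn n); set X := bigop _ _ _; nia.
Qed.

(** * Words as points of the box *)

Definition map_word (d : nat) (T V : finType) (f : T -> V)
  (w : {ffun 'I_d -> T}) : {ffun 'I_d -> V} := [ffun i => f (w i)].

Definition row_of_word (n d : nat) (w : {ffun 'I_d -> 'I_n}) : 'rV[int]_d :=
  \row_i (w i : nat)%:Z.

Lemma row_of_word_inj (n d : nat) : injective (@row_of_word n d).
Proof.
move=> u v /rowP e; apply/ffunP => i; apply/val_inj.
by have := e i; rewrite !mxE => -[].
Qed.

Lemma in_box_row_of_word (n d : nat) (F : {set {ffun 'I_d -> 'I_n}}) :
  in_box n [fset row_of_word w | w in F]%fset.
Proof.
move=> a /imfsetP[w _ ->] i; rewrite mxE.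
by apply/imfsetP; exists (val (w i)) => //=; rewrite mem_iota /= ltn_ord.
Qed.

Lemma occurrences_map_word (d : nat) (T V : finType) (f : T -> V)
    (B : {set V}) (w : {ffun 'I_d -> T}) :
  occurrences B (map_word f w) = occurrences (f @^-1: B) w.
Proof. by apply: eq_card => i; rewrite !inE ffunE. Qed.

(** Splitting a word of quadruples into its four component words is injective and yields an additive
    quadruple of rows. *)
Lemma additive_energy_words_ge (n d : nat) (F : {set {ffun 'I_d -> 'I_n}}) :
  (#|[set w in ffun_on (mem (quads n)) |
      [&& map_word (fun q => q.1.1) w \in F, map_word (fun q => q.1.2) w \in F,
          map_word (fun q => q.2.1) w \in F & map_word (fun q => q.2.2) w \in F]]|
    <= additive_energy [fset row_of_word w | w in F]%fset)%N.
Proof.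
rewrite additive_energy_imfset; last exact: row_of_word_inj.
set W := [set w in _ | _].
pose h (w : {ffun 'I_d -> ('I_n * 'I_n) * ('I_n * 'I_n)}) :=
  ((map_word (fun q => q.1.1) w, map_word (fun q => q.1.2) w),
   (map_word (fun q => q.2.1) w, map_word (fun q => q.2.2) w)).
have h_inj : injective h.
  move=> u v [/ffunP e1 /ffunP e2 /ffunP e3 /ffunP e4]; apply/ffunP => i.
  move: (e1 i) (e2 i) (e3 i) (e4 i); rewrite !ffunE.
  by case: (u i) (v i) => [[a b] [c e]] [[a' b'] [c' e']] /= -> -> -> ->.
rewrite -(card_imset (mem W) h_inj); apply/subset_leq_card/fintype.subsetP => x.
case/imsetP => w; rewrite !inE => /andP[/ffun_onP wq wF] ->.
case/and4P: wF => /= -> -> -> -> /=.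
apply/eqP/rowP => i; rewrite !mxE !ffunE -!PoszD; congr Posz.
by have := wq i; rewrite inE => /eqP.
Qed.

(** By the symmetries of the equation, zero is equally frequent in all four positions; [s] is a
    symmetry moving the position read by [f] to the first. *)
Lemma card_quads_preim (n : nat) (z : 'I_n)
    (f : ('I_n * 'I_n) * ('I_n * 'I_n) -> 'I_n)
    (s : ('I_n * 'I_n) * ('I_n * 'I_n) -> ('I_n * 'I_n) * ('I_n * 'I_n)) :
  val z = 0%N -> injective s -> (forall q, f q = (s q).1.1) ->
  (forall q, (s q \in quads n) = (q \in quads n)) ->
  (2 * #|quads n :&: f @^-1: [set z]| = n * n.+1)%N.
Proof.
move=> z0 s_inj fs qs; rewrite -(card_quads0 z0).
rewrite -[in RHS](card_preimset _ s_inj).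
by congr (2 * _)%N; apply: eq_card => q; have := qs q; rewrite !inE fs => ->.
Qed.

(** * Exponential estimates *)

(** The factor 4 accounts for the four positions of a quadruple; both powers are pushed below
    1/5. *)
Lemma geometric_lt1 (R : realType) (a b : R) :
  0 <= a < 1 -> 0 <= b < 1 -> exists d, (0 < d)%N /\ 4 * a ^+ d + b ^+ d < 1.
Proof.
move=> /andP[a0 a1] /andP[b0 b1].
have lim (x : R) : 0 <= x -> x < 1 ->
    exists N, forall d, (N <= d)%N -> x ^+ d < 1 / 5.
  move=> x0 x1.
  have h : ((fun d => x ^+ d) @ \oo --> (0 : R))%classic.
    by apply: cvg_expr; rewrite ger0_norm.
  have [|N _ hN] := cvgr_lt _ h (1 / 5); first by lra.
  by exists N => d /hN.
have [[M hM] [N hN]] := (lim a a0 a1, lim b b0 b1).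
exists (maxn M N).+1; split=> //.
have := hM (maxn M N).+1 (leqW (leq_maxl _ _)).
by have := hN (maxn M N).+1 (leqW (leq_maxr _ _)); lra.
Qed.

Lemma card_words_le (R : realType) (n d : nat) (z : 'I_n) (theta : R) :
  0 < theta -> theta < n%:R^-1 ->
  #|[set w : {ffun 'I_d -> 'I_n} |
      (occurrences [set z] w)%:R <= theta * d%:R]|%:R
    <= (n%:R * chernoff_rate n%:R^-1 theta) ^+ d.
Proof.
move=> t0 tn; have n0 : (0 < n)%N by apply: leq_ltn_trans (ltn_ord z).
rewrite -[X in (X%:R * _) ^+ d](card_ord n) -[X in (X%:R * _) ^+ d]cardsT.
have p0 : 0 < n%:R^-1 :> R by rewrite invr_gt0 ltr0n.
apply: (@chernoff_bound _ _ _ [set z]) => //.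
  by rewrite finset.setTI cards1 cardsT card_ord mulVf// pnatr_eq0 -lt0n.
move=> w; rewrite inE => hw; split; first by apply/ffun_onP => i; rewrite inE.
have y0 : 0 < theta / n%:R^-1 by rewrite divr_gt0.
rewrite -powR_mulrn; last exact: ltW.
(* Lower tail: the base is below 1, so fewer zeros give a larger power. *)
by apply: ger_powR => //; rewrite y0 ler_pdivrMr// mul1r ltW.
Qed.

Lemma card_bad_quads_le (R : realType) (n d : nat) (z : 'I_n) (theta : R)
    (f : ('I_n * 'I_n) * ('I_n * 'I_n) -> 'I_n) :
  let p := (n * n.+1)%:R / (2 * #|quads n|)%:R in
  (2 * #|quads n :&: f @^-1: [set z]| = n * n.+1)%N -> p < theta ->
  #|[set w in ffun_on (mem (quads n)) |
      map_word f w \notin [set w : {ffun 'I_d -> 'I_n} |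
        (occurrences [set z] w)%:R <= theta * d%:R]]|%:R
    <= (#|quads n|%:R * chernoff_rate p theta) ^+ d.
Proof.
move=> p hf tp; have n0 : (0 < n)%N by apply: leq_ltn_trans (ltn_ord z).
have E0 : (0 < #|quads n|)%N by have := card_quads n; nia.
have p0 : 0 < p by rewrite divr_gt0 ?ltr0n ?muln_gt0 ?n0.
apply: (@chernoff_bound _ _ _ (f @^-1: [set z])) => //.
- exact: lt_trans tp.
- rewrite /p -hf !natrM; field.
  by rewrite pnatr_eq0 -lt0n.
move=> w; rewrite !inE -ltNge occurrences_map_word => /andP[wq hw].
split=> //; have y1 : 1 <= theta / p by rewrite ler_pdivlMr// mul1r ltW.
rewrite -powR_mulrn; last exact: le_trans y1.
by apply: ler_powR => //; exact: ltW.
Qed.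

(** * Comparison of the energy with the size of the set *)

Theorem theorem1p2 (R : realType) (n : nat) (hn : (3 <= n)%N) :
  energy_exponent R n > logb n%:R (additive_energy (int_segment n))%:R
  /\ logb n%:R (additive_energy (int_segment n))%:R
     = logb n%:R ((2 * n%:R ^+ 3 + n%:R) / 3) :> R.
Proof.
rewrite additive_energy_int_segment; set E := #|quads n|.
have hE : (3 * E = 2 * n ^ 3 + n)%N := card_quads n.
split; last first.
  congr (logb _ _); have := congr1 (fun k => k%:R : R) hE.
  by rewrite natrM natrD natrM natrX => <-; field.
have n0 : (0 < n)%N by lia.
have E1 : (1 < E)%N by move: hE; rewrite !expnS expn0; nia.
have nR : 1 < n%:R :> R by rewrite ltr1n; lia.
have ER : 1 < E%:R :> R by rewrite ltr1n.
set s := logb _ _.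
have s0 : 0 < s by rewrite divr_gt0// ln_gt0.
have ns : n%:R `^ s = E%:R :> R.
  rewrite /powR gt_eqF ?(lt_trans ltr01)// /s /logb divfK ?lnK ?posrE ?ltr0n//.
    by lia.
  by rewrite gt_eqF// ln_gt0.
pose p : R := (n * n.+1)%:R / (2 * E)%:R.
have p0 : 0 < p by rewrite divr_gt0 ?ltr0n ?muln_gt0 ?n0//=; lia.
(* Clearing denominators gives n(n-1)(n-2) > 0, hence the requirement [3 <= n]. *)
have pn : p < n%:R^-1.
  rewrite ltr_pdivrMr ?ltr0n; last by lia.
  rewrite mulrC ltr_pdivlMr ?ltr0n// -natrM ltr_nat.
  by move: hE; rewrite !expnS expn0; nia.
pose theta := (p + n%:R^-1) / 2.
have pt : p < theta by rewrite /theta; lra.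
have tn : theta < n%:R^-1 by rewrite /theta; lra.
have t0 : 0 < theta by exact: lt_trans pt.
have [exponentE _] := @energy_exponent_min R n (ltnW hn).
rewrite ltNge; apply/negP => ts.
pose r1 := chernoff_rate p theta; pose r2 := chernoff_rate n%:R^-1 theta.
have r1_lt1 : r1 < 1 by apply: chernoff_rate_lt1; rewrite ?gt_eqF.
have r2_lt1 : r2 < 1.
  by apply: chernoff_rate_lt1; rewrite ?lt_eqF// invr_gt0 ltr0n.
have r2s : 0 <= r2 `^ s < 1.
  rewrite powR_ge0 /= /powR gt_eqF ?expR_gt0// expR_lt1 pmulr_rlt0//.
  by rewrite ln_lt0// expR_gt0.
have [|d [d0]] := @geometric_lt1 _ r1 _ _ r2s; first by rewrite expR_ge0.
apply/negP; rewrite -leNgt.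
pose z := Ordinal n0.
pose F := [set w : {ffun 'I_d -> 'I_n} |
  (occurrences [set z] w)%:R <= theta * d%:R].
pose A := [fset row_of_word w | w in F]%fset.
have cA : #|` A| = #|F| by rewrite card_imfset ?cardE//; exact: row_of_word_inj.
have F_gt0 : (0 < #|F|)%N.
  have n1 : (1 < n)%N by lia.
  apply/card_gt0P; exists [ffun=> Ordinal n1]; rewrite inE.
  have -> : @occurrences d _ [set z] [ffun=> Ordinal n1] = 0%N :> nat.
    by apply/eqP; rewrite /occurrences cards_eq0; apply/eqP/setP => i;
      rewrite !inE ffunE.
  by rewrite mulr_ge0 ?ler0n// ltW.
have upper : (additive_energy A)%:R <= (E%:R * r2 `^ s) ^+ d.
  have /le_trans -> // := exponentE d A d0 (@in_box_row_of_word _ _ F).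
  rewrite cA.
  apply: (@le_trans _ _ (#|F|%:R `^ s)); first by rewrite ler_powR// ler1n.
  rewrite -ns -powRM ?ler0n ?expR_ge0//.
  rewrite -(powR_mulrn d (powR_ge0 _ _)) powRAC powR_mulrn;
    last by rewrite mulr_ge0 ?expR_ge0.
  apply: ge0_ler_powR; rewrite ?nnegrE ?ler0n//; first exact: ltW.
    by rewrite exprn_ge0// mulr_ge0 ?expR_ge0.
  exact: card_words_le.
(* Union bound: each of the E^d words of quadruples either has all four components in [F] or is bad
   at some position. *)
have lower : E%:R ^+ d <= (additive_energy A)%:R + 4 * (E%:R * r1) ^+ d.
  pose bad (f : ('I_n * 'I_n) * ('I_n * 'I_n) -> 'I_n) :=
    [set w in ffun_on (mem (quads n)) | map_word f w \notin F].
  have badE f s' : injective s' -> (forall q, f q = (s' q).1.1) ->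
      (forall q, (s' q \in quads n) = (q \in quads n)) ->
      #|bad f|%:R <= (E%:R * r1) ^+ d.
    by move=> i1 i2 i3; apply: card_bad_quads_le => //; exact: card_quads_preim i3.
  have b1 : #|bad (fun q => q.1.1)|%:R <= (E%:R * r1) ^+ d.
    by apply: (badE _ id).
  have b2 : #|bad (fun q => q.1.2)|%:R <= (E%:R * r1) ^+ d.
    apply: (badE _ (fun q => ((q.1.2, q.1.1), q.2))) => //.
      by move=> [[a b] [c e]] [[a' b'] [c' e']] [-> -> -> ->].
    by move=> q; rewrite !inE /= addnC.
  have b3 : #|bad (fun q => q.2.1)|%:R <= (E%:R * r1) ^+ d.
    apply: (badE _ (fun q => (q.2, q.1))) => //.
      by move=> [x y] [x' y'] [-> ->].
    by move=> q; rewrite !inE /= eq_sym.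
  have b4 : #|bad (fun q => q.2.2)|%:R <= (E%:R * r1) ^+ d.
    apply: (badE _ (fun q => ((q.2.2, q.2.1), q.1))) => //.
      by move=> [[a b] [c e]] [[a' b'] [c' e']] [-> -> -> ->].
    by move=> q; rewrite !inE /= eq_sym [(val q.2.2 + _)%N]addnC.
  have : (E ^ d <= additive_energy A + #|bad (fun q => q.1.1)|
      + #|bad (fun q => q.1.2)| + #|bad (fun q => q.2.1)|
      + #|bad (fun q => q.2.2)|)%N.
    have -> : (E ^ d =
        #|[set w : {ffun 'I_d -> _} in ffun_on (mem (quads n))]|)%N.
      by rewrite cardsE card_ffun_on card_ord.
    have := additive_energy_words_ge F; set G := [set w in _ | _] => hG.
    apply: (@leq_trans #|G :|: bad (fun q => q.1.1) :|: bad (fun q => q.1.2)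
      :|: bad (fun q => q.2.1) :|: bad (fun q => q.2.2)|).
      apply/subset_leq_card/fintype.subsetP => w.
      rewrite !finset.in_setU !finset.in_set => -> /=.
      by do 4![case: (_ <= theta * _)%R => //=].
    do 3 (apply: (leq_trans (leq_card_setU _ _)); rewrite leq_add2r).
    by apply: (leq_trans (leq_card_setU _ _)); rewrite leq_add2r.
  by rewrite -(ler_nat R) natrX !natrD; lra.
have Ed : 0 < E%:R ^+ d :> R by rewrite exprn_gt0// (lt_trans ltr01).
(* Scaling by E^d reduces the claim to the combination of [lower] and [upper]. *)
rewrite -(ler_pM2l Ed); move: (le_trans lower (lerD upper (lexx _))).
by rewrite !exprMn; lra.
Qed.
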